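(* For each integer $n\geq 1$ let $Q_{n-1}$ be a polynomial of degree at most $n-1$ satisfying conditions (i) and (ii) of the context, with nodes $x_{n,k}$, and let $R_n:C[0,1]\to C[0,1]$ be the associated rational Bernstein operator. Put $\Delta_n=\sup_{0\leq k\leq n-1}|x_{n,k+1}-x_{n,k}|$ and assume that $\Delta_n\to 0$ as $n\to\infty$. Then for every $f\in C^2[0,1]$ and every $x\in(0,1)$, $$\frac{R_nf(x)-f(x)}{R_n\left[(e_1-x)^2\right](x)}\longrightarrow\frac12 f''(x)\qquad\text{as } n\to\infty.$$
   Context: $C[0,1]$ is the space of continuous real-valued functions on $[0,1]$, and $C^2[0,1]$ the space of twice continuously differentiable ones. For fixed $x$, $R_n[(e_1-x)^r](x)$ denotes the value at $x$ of $R_n$ applied to the function $t\mapsto(t-x)^r$. Let $n\geq 1$ and let $Q_{n-1}$ be a polynomial of degree at most $n-1$, strictly positive on $[0,1]$. Write $Q_{n-1}(x)=\sum_{k=0}^{n-1}\gamma_{n-1,k}\,x^k(1-x)^{n-1-k}$ and $\gamma_{n-1,k}=w_{n-1,k}\binom{n-1}{k}$, so that the $w_{n-1,k}$ are the Bernstein coefficients of $Q_{n-1}$. Conditions: (i) $w_{n-1,k}>0$ for $k=0,\dots,n-1$; (ii) property (W): $\frac{w_{n-1,k-1}w_{n-1,k+1}}{w_{n-1,k}^2}<\frac{k+1}{k}\cdot\frac{n-k}{n-k-1}$ for $k=1,\dots,n-2$ (equivalently, $\gamma_{n-1,k-1}/\gamma_{n-1,k}$ is strictly increasing in $k=1,\dots,n-1$).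 Convention: $\gamma_{n-1,-1}=\gamma_{n-1,n}=0$. The nodes are $x_{n,k}=\frac{\gamma_{n-1,k-1}}{\gamma_{n-1,k}+\gamma_{n-1,k-1}}$ for $k=0,\dots,n$; under (i) and (ii) one has $0=x_{n,0}<x_{n,1}<\dots<x_{n,n}=1$. The rational Bernstein operator associated with $Q_{n-1}$ is $$R_nf(x)=\sum_{k=0}^{n}f(x_{n,k})\,(\gamma_{n-1,k}+\gamma_{n-1,k-1})\,\frac{x^k(1-x)^{n-k}}{Q_{n-1}(x)},\qquad f\in C[0,1],$$ which reproduces the functions $1$ and $x$. *)

(* Defs.v *)
From HB Require Import structures.
From mathcomp Require Import all_boot all_order all_algebra.
From mathcomp Require Import all_classical all_reals all_analysis.

Set Implicit Arguments.
Unset Strict Implicit.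
Unset Printing Implicit Defensive.

Import Order.TTheory GRing.Theory Num.Theory.
Import numFieldNormedType.Exports.

Local Open Scope classical_set_scope.
Local Open Scope ring_scope.

Section RationalBernstein.
Context {R : realType}.

(* In this section w 0, ..., w n.-1 are the Bernstein coefficients of a
   polynomial of degree at most n.-1; the values w k with n <= k are never
   used, because they are always multiplied by a zero binomial coefficient. *)

(* gamma_{n-1,k}; in particular gamma_{n-1,n} = 0 for 0 < n. *)
Definition bgamma (n : nat) (w : nat -> R) (k : nat) : R :=
  w k * 'C(n.-1, k)%:R.

(* gamma_{n-1,k-1}, with the convention gamma_{n-1,-1} = 0. *)
Definition bgamma_pred (n : nat) (w : nat -> R) (k : nat) : R :=
  if k is j.+1 then bgamma n w j else 0.

Definition bnode (n : nat) (w : nat -> R) (k : nat) : R :=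
  bgamma_pred n w k / (bgamma n w k + bgamma_pred n w k).

(* Functions on [0, 1] are represented by total functions R -> R; only the
   values at the nodes, which lie in [0, 1], matter. *)
Definition rat_bernstein (n : nat) (Q : {poly R}) (w : nat -> R)
    (f : R -> R) (x : R) : R :=
  \sum_(k < n.+1) f (bnode n w k) * (bgamma n w k + bgamma_pred n w k) *
    (x ^+ k * (1 - x) ^+ (n - k) / Q.[x]).

Definition bernstein_coefs (n : nat) (Q : {poly R}) (w : nat -> R) : Prop :=
  Q = \sum_(k < n) bgamma n w k *: ('X^k * (1 - 'X) ^+ (n.-1 - k)).

Definition property_W (n : nat) (w : nat -> R) : Prop :=
  forall k : nat, (1 <= k <= n - 2)%N ->
    w k.-1 * w k.+1 / w k ^+ 2 <
      (k.+1%:R / k%:R) * ((n - k)%:R / (n - k - 1)%:R).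

(* The terms are nonnegative, so for 0 < n this is the maximum of the gaps. *)
Definition mesh (n : nat) (w : nat -> R) : R :=
  \big[Num.max/0]_(k < n) `|bnode n w k.+1 - bnode n w k|.

(* g is the derivative of f relative to A at every point of A: when A is
   `[a, b], this is the one-sided derivative at the endpoints. *)
Definition has_derivative_on (A : set R) (f g : R -> R) : Prop :=
  forall x, A x -> (f y - f x) / (y - x) @[y --> within A x^'] --> g x.

Definition C2_on (A : set R) (f : R -> R) : Prop :=
  exists f1 f2 : R -> R,
    [/\ has_derivative_on A f f1, has_derivative_on A f1 f2
      & {within A, continuous f2}].

End RationalBernstein.

(* Main.v *)
Require Import Defs.
From HB Require Import structures.
From mathcomp Require Import all_boot all_order all_algebra.
From mathcomp Require Import all_classical all_reals all_analysis.
From mathcomp Require Import ring lra zify.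

Set Implicit Arguments.
Unset Strict Implicit.
Unset Printing Implicit Defensive.

Import Order.TTheory GRing.Theory Num.Theory.
Import numFieldNormedType.Exports.

Local Open Scope classical_set_scope.
Local Open Scope ring_scope.

(** Let p_k be the weights and t_k the nodes of R_n at x.  The choice of the
    nodes splits each weight into t_k p_k = x q_{k-1} and
    (1 - t_k) p_k = (1 - x) q_k, where q_k = gamma_k x^k (1-x)^(n-1-k) / Q(x).
    Comparing the two expressions of q_k gives the balance relation
      x (1 - t_k) p_k = (1 - x) t_{k+1} p_{k+1},
    i.e. p is the stationary law of a birth and death chain on the nodes with
    birth rates x (1 - t_k) and death rates (1 - x) t_k.

    Since (1 - x) t_k - x (1 - t_k) = t_k - x, summation by parts turns the
    balance relation into a Stein identity
      sum p_k (t_k - x) g_k = sum x (1 - t_k) p_k (g_{k+1} - g_k).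
    For g = 1 it says that the mean of the nodes is x.  For g_k = (t_k - x)^3,
    the difference of two cubes is at most 3/2 |t_{k+1} - t_k| times the sum
    of the two squares, and using the balance relation once more one obtains
      R_n[(e_1 - x)^4](x) <= 3/2 Delta_n R_n[(e_1 - x)^2](x)
    (fourth_moment_le).  So the fourth moment is negligible with respect to
    the second one as soon as the mesh tends to 0.

    On the other hand, for every e > 0 a C^2 function satisfies on the whole of
    [0, 1]
      |f(t) - f(x) - f'(x)(t - x) - f''(x)/2 (t - x)^2|
        <= e (t - x)^2 + C (t - x)^4
    (C2_taylor): Taylor's formula near x gives the first term, boundedness of
    f away from x the second.  Averaging over the nodes bounds
    R_n f(x) - f(x) - f''(x)/2 R_n[(e_1 - x)^2](x) by
    (e + 3/2 C Delta_n) R_n[(e_1 - x)^2](x) (voronovskaja_estimate);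
    dividing by the second moment, which is positive, gives the limit. *)

(** * The Stein identity and the fourth moment *)

(** Stationarity of p for the chain that moves from node k to node k + 1 at
    rate x (1 - t k) and back at rate (1 - x) t (k + 1). *)
Definition detailed_balance (R : comPzRingType) (n : nat) (p t : nat -> R)
    (x : R) : Prop :=
  forall k, (k < n)%N -> x * (1 - t k) * p k = (1 - x) * t k.+1 * p k.+1.

(** The death rate vanishes at t_0 = 0, so each downward step k + 1 -> k can be
    matched with the upward step k -> k + 1. *)
Lemma detailed_balance_sum (R : comPzRingType) (n : nat) (p t g : nat -> R)
    (x : R) :
  detailed_balance n p t x -> t 0%N = 0 ->
  \sum_(k < n.+1) (1 - x) * t k * p k * g k =
  \sum_(k < n) x * (1 - t k) * p k * g k.+1.
Proof.
move=> bal t0; rewrite big_ord_recl/= t0 mulr0 !mul0r add0r.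
by apply: eq_bigr => k _; rewrite bal.
Qed.

Lemma sum_birth_rate (R : pzRingType) (n : nat) (p t g : nat -> R) (x : R) :
  t n = 1 ->
  \sum_(k < n.+1) x * (1 - t k) * p k * g k =
  \sum_(k < n) x * (1 - t k) * p k * g k.
Proof. by move=> tn; rewrite big_ord_recr/= tn subrr mulr0 !mul0r addr0. Qed.

(** Write t_k - x as death rate minus birth rate, (1 - x) t_k - x (1 - t_k),
    and sum the death part by detailed balance. *)
Lemma stein_identity (R : comPzRingType) (n : nat) (p t g : nat -> R) (x : R) :
  detailed_balance n p t x -> t 0%N = 0 -> t n = 1 ->
  \sum_(k < n.+1) p k * ((t k - x) * g k) =
  \sum_(k < n) x * (1 - t k) * p k * (g k.+1 - g k).
Proof.
move=> bal t0 tn.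
under [RHS]eq_bigr => k _ do rewrite mulrBr.
rewrite sumrB -(detailed_balance_sum g bal t0) -(sum_birth_rate p g x tn) -sumrB.
by apply: eq_bigr => k _; ring.
Qed.

(** a^3 - b^3 = (a - b)(a^2 + a b + b^2) and a b <= (a^2 + b^2) / 2. *)
Lemma subr_cube_le (R : realFieldType) (a b D : R) :
  `|a - b| <= D -> a ^+ 3 - b ^+ 3 <= 3 / 2 * D * (a ^+ 2 + b ^+ 2).
Proof.
move=> abD; have D0 : 0 <= D := le_trans (normr_ge0 _) abD.
have {}abD := le_trans (ler_norm _) abD.
have ab0 : 0 <= a ^+ 2 + a * b + b ^+ 2 by nra.
have -> : a ^+ 3 - b ^+ 3 = (a - b) * (a ^+ 2 + a * b + b ^+ 2) by ring.
apply: (le_trans (ler_wpM2r ab0 abD)).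
rewrite [3 / 2 * D]mulrC -mulrA ler_wpM2l//.
have := sqr_ge0 (a - b); rewrite sqrrB; lra.
Qed.

(** The Stein identity for (t_k - x)^3.  The squares at k and k + 1 produced by
    subr_cube_le come with the birth rate at k; detailed balance turns the
    latter into the death rate at k + 1, and birth plus death rates are at
    most 1. *)
Lemma fourth_moment_le (R : realFieldType) (n : nat) (p t : nat -> R)
    (x D : R) :
  detailed_balance n p t x -> t 0%N = 0 -> t n = 1 ->
  0 <= x <= 1 ->
  (forall k, (k <= n)%N -> 0 <= t k <= 1) ->
  (forall k, (k <= n)%N -> 0 <= p k) ->
  (forall k, (k < n)%N -> `|t k.+1 - t k| <= D) ->
  \sum_(k < n.+1) p k * (t k - x) ^+ 4 <=
  3 / 2 * D * \sum_(k < n.+1) p k * (t k - x) ^+ 2.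
Proof.
move=> bal t0 tn /andP[x0 x1] t01 p0 tD.
(* For n = 0 the endpoint conditions 0 = t_0 = t_n = 1 are contradictory. *)
have D0 : 0 <= D.
  case: n tn tD {bal t01 p0} => [|n] tn tD.
    by have := oner_eq0 R; rewrite -tn t0 eqxx.
  exact: le_trans (normr_ge0 _) (tD 0%N _).
under eq_bigr => k _ do rewrite exprS.
rewrite (stein_identity (fun k => (t k - x) ^+ 3) bal t0 tn).
pose s k := (t k - x) ^+ 2.
apply: (@le_trans _ _ (3 / 2 * D * \sum_(k < n.+1)
    (x * (1 - t k) * p k * s k + (1 - x) * t k * p k * s k))).
  rewrite big_split/= (sum_birth_rate p s x tn) (detailed_balance_sum s bal t0).
  rewrite -big_split mulr_sumr; apply: ler_sum => k _ /=.
  have kn := ltnW (ltn_ord k); have /andP[tk0 tk1] := t01 k kn.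
  rewrite -mulrDr mulrCA ler_wpM2l//.
    by rewrite !mulr_ge0 ?p0 ?subr_ge0.
  rewrite [s k + _]addrC; apply: subr_cube_le.
  by rewrite opprB addrA subrK tD.
rewrite ler_wpM2l ?mulr_ge0//; apply: ler_sum => k _.
rewrite -mulrDl -mulrDl -[p k * _]mul1r mulrA.
have kn : (k <= n)%N by rewrite -ltnS.
rewrite !ler_wpM2r ?sqr_ge0 ?p0//.
have /andP[tk0 tk1] := t01 k kn; nra.
Qed.

(** The Taylor bound is averaged against p: the linear term disappears because
    the mean of the nodes is x, and the quartic one is absorbed into the second
    moment by fourth_moment_le. *)
Lemma voronovskaja_estimate (R : realFieldType) (n : nat) (p t : nat -> R)
    (f : R -> R) (x D a b e C : R) :
  detailed_balance n p t x -> t 0%N = 0 -> t n = 1 ->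
  0 <= x <= 1 ->
  (forall k, (k <= n)%N -> 0 <= t k <= 1) ->
  (forall k, (k <= n)%N -> 0 <= p k) ->
  \sum_(k < n.+1) p k = 1 ->
  (forall k, (k < n)%N -> `|t k.+1 - t k| <= D) ->
  0 <= C ->
  (forall u, 0 <= u <= 1 ->
    `|f u - f x - a * (u - x) - b * (u - x) ^+ 2|
      <= e * (u - x) ^+ 2 + C * (u - x) ^+ 4) ->
  `|\sum_(k < n.+1) p k * f (t k) - f x
      - b * \sum_(k < n.+1) p k * (t k - x) ^+ 2|
    <= (e + C * (3 / 2 * D)) * \sum_(k < n.+1) p k * (t k - x) ^+ 2.
Proof.
move=> bal t0 tn x01 t01 p0 p1 tD C0 taylor.
have p_le k : 0 <= p (k : 'I_n.+1) by rewrite p0// -ltnS.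
have mean0 : \sum_(k < n.+1) p k * (t k - x) = 0.
  transitivity (\sum_(k < n.+1) p k * ((t k - x) * 1)).
    by apply: eq_bigr => k _; rewrite mulr1.
  rewrite (stein_identity (fun=> 1) bal t0 tn) big1// => k _.
  by rewrite subrr mulr0.
have -> : \sum_(k < n.+1) p k * f (t k) - f x
    - b * \sum_(k < n.+1) p k * (t k - x) ^+ 2
    = \sum_(k < n.+1)
        p k * (f (t k) - f x - a * (t k - x) - b * (t k - x) ^+ 2).
  transitivity (\sum_(k < n.+1) p k * f (t k) - \sum_(k < n.+1) p k * f x
      - a * \sum_(k < n.+1) p k * (t k - x)
      - b * \sum_(k < n.+1) p k * (t k - x) ^+ 2).
    by rewrite mean0 mulr0 subr0 -mulr_suml p1 mul1r.
  by rewrite !mulr_sumr -!sumrB; apply: eq_bigr => k _; ring.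
rewrite (le_trans (ler_norm_sum _ _ _))//.
apply: (@le_trans _ _ (\sum_(k < n.+1)
    (e * (p k * (t k - x) ^+ 2) + C * (p k * (t k - x) ^+ 4)))).
  apply: ler_sum => k _; rewrite normrM ger0_norm//.
  rewrite !(mulrCA _ (p k)) -mulrDr ler_wpM2l// taylor// t01// -ltnS.
  by [].
rewrite big_split/= -!mulr_sumr mulrDl lerD2l -mulrA ler_wpM2l//.
exact: fourth_moment_le.
Qed.

(** * Weights and nodes of the rational Bernstein operator *)

Definition rb_weight (R : realType) (n : nat) (Q : {poly R}) (w : nat -> R)
    (x : R) (k : nat) : R :=
  (bgamma n w k + bgamma_pred n w k) * (x ^+ k * (1 - x) ^+ (n - k) / Q.[x]).

Lemma rat_bernsteinE (R : realType) (n : nat) (Q : {poly R}) (w : nat -> R)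
    (f : R -> R) (x : R) :
  rat_bernstein n Q w f x =
  \sum_(k < n.+1) rb_weight n Q w x k * f (bnode n w k).
Proof. by apply: eq_bigr => k _; rewrite -mulrA mulrC. Qed.

Lemma bgamma_ge0 (R : realType) (n : nat) (w : nat -> R) (k : nat) :
  (0 < n)%N -> (forall k, (k <= n.-1)%N -> 0 < w k) -> 0 <= bgamma n w k.
Proof.
move=> n0 w0; rewrite /bgamma; case: (leqP k n.-1) => kn.
  by rewrite mulr_ge0// ltW// w0.
by rewrite bin_small// mulr0.
Qed.

Lemma bgamma_gt0 (R : realType) (n : nat) (w : nat -> R) (k : nat) :
  (forall k, (k <= n.-1)%N -> 0 < w k) -> (k <= n.-1)%N -> 0 < bgamma n w k.
Proof. by move=> w0 kn; rewrite mulr_gt0 ?w0// ltr0n bin_gt0. Qed.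

Lemma bgamma_top (R : realType) (n : nat) (w : nat -> R) :
  (0 < n)%N -> bgamma n w n = 0.
Proof. by move=> n0; rewrite /bgamma bin_small ?mulr0// prednK. Qed.

Lemma bgamma_pred_ge0 (R : realType) (n : nat) (w : nat -> R) (k : nat) :
  (0 < n)%N -> (forall k, (k <= n.-1)%N -> 0 < w k) -> 0 <= bgamma_pred n w k.
Proof. by move=> n0 w0; case: k => //= k; exact: bgamma_ge0. Qed.

Lemma bgammaD_gt0 (R : realType) (n : nat) (w : nat -> R) (k : nat) :
  (0 < n)%N -> (forall k, (k <= n.-1)%N -> 0 < w k) -> (k <= n)%N ->
  0 < bgamma n w k + bgamma_pred n w k.
Proof.
move=> n0 w0; case: k => [_|k kn] /=.
  by rewrite addr0 bgamma_gt0.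
by rewrite ltr_wpDl ?bgamma_ge0// bgamma_gt0// -ltnS prednK.
Qed.

Lemma bnode_itv (R : realType) (n : nat) (w : nat -> R) (k : nat) :
  (0 < n)%N -> (forall k, (k <= n.-1)%N -> 0 < w k) -> (k <= n)%N ->
  0 <= bnode n w k <= 1.
Proof.
move=> n0 w0 kn; have s0 := bgammaD_gt0 n0 w0 kn.
rewrite divr_ge0 ?(ltW s0) ?bgamma_pred_ge0//=.
by rewrite ler_pdivrMr// mul1r lerDr bgamma_ge0.
Qed.

Lemma bnode0 (R : realType) (n : nat) (w : nat -> R) : bnode n w 0 = 0.
Proof. by rewrite /bnode mul0r. Qed.

Lemma bnode_last (R : realType) (n : nat) (w : nat -> R) :
  (0 < n)%N -> (forall k, (k <= n.-1)%N -> 0 < w k) -> bnode n w n = 1.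
Proof.
move=> n0 w0; have := bgammaD_gt0 n0 w0 (leqnn n).
by rewrite /bnode bgamma_top// add0r => /lt0r_neq0; exact: divff.
Qed.

Lemma rb_weight_gt0 (R : realType) (n : nat) (Q : {poly R}) (w : nat -> R)
    (x : R) (k : nat) :
  (0 < n)%N -> (forall k, (k <= n.-1)%N -> 0 < w k) -> (k <= n)%N ->
  0 < x < 1 -> 0 < Q.[x] -> 0 < rb_weight n Q w x k.
Proof.
move=> n0 w0 kn /andP[x0 x1] Q0.
by rewrite mulr_gt0 ?bgammaD_gt0// divr_gt0// mulr_gt0// exprn_gt0// subr_gt0.
Qed.

(** Both sides equal gamma_k x^(k+1) (1-x)^(n-k) / Q(x): multiplying a weight
    by its node, or by one minus its node, leaves a single gamma. *)
Lemma rb_weight_balance (R : realType) (n : nat) (Q : {poly R})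
    (w : nat -> R) (x : R) :
  (0 < n)%N -> (forall k, (k <= n.-1)%N -> 0 < w k) ->
  detailed_balance n (rb_weight n Q w x) (bnode n w) x.
Proof.
move=> n0 w0 k kn.
have node_mul j : (j <= n)%N ->
    bnode n w j * (bgamma n w j + bgamma_pred n w j) = bgamma_pred n w j.
  by move=> jn; rewrite divfK// lt0r_neq0// bgammaD_gt0.
transitivity (bgamma n w k * (x ^+ k.+1 * (1 - x) ^+ (n - k) / Q.[x])).
  transitivity (x * (bgamma n w k + bgamma_pred n w k
      - bnode n w k * (bgamma n w k + bgamma_pred n w k))
      * (x ^+ k * (1 - x) ^+ (n - k) / Q.[x])).
    by rewrite /rb_weight; ring.
  by rewrite node_mul ?(ltnW kn)// addrK exprS; ring.
transitivity ((1 - x) * (bnode n w k.+1 * (bgamma n w k.+1 +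
    bgamma_pred n w k.+1)) * (x ^+ k.+1 * (1 - x) ^+ (n - k.+1) / Q.[x])).
  by rewrite node_mul// -(subnSK kn) (exprS (1 - x)) /=; ring.
by rewrite /rb_weight; ring.
Qed.

(** Each weight splits into a gamma_k part and a gamma_{k-1} part; collecting
    the two parts that carry the same gamma_k gives (1 - x) + x = 1 times the
    k-th Bernstein term of Q. *)
Lemma rb_weight_sum (R : realType) (n : nat) (Q : {poly R}) (w : nat -> R)
    (x : R) :
  (0 < n)%N -> bernstein_coefs n Q w -> Q.[x] != 0 ->
  \sum_(k < n.+1) rb_weight n Q w x k = 1.
Proof.
move=> n0 QE Qx0.
have Qx : Q.[x] = \sum_(k < n) bgamma n w k * (x ^+ k * (1 - x) ^+ (n.-1 - k)).
  rewrite QE horner_sum; apply: eq_bigr => k _.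
  by rewrite !hornerE.
under eq_bigr => k _ do rewrite /rb_weight mulrA mulrDl.
rewrite -mulr_suml big_split/= big_ord_recr/= bgamma_top// mul0r addr0.
rewrite [X in _ + X]big_ord_recl/= mul0r add0r -big_split/=.
rewrite -[RHS](divff Qx0) {2}Qx; congr (_ / _); apply: eq_bigr => k _.
rewrite /bump/= add1n -mulrDr; congr (_ * _).
have -> : (n - k = (n.-1 - k).+1)%N by have := ltn_ord k; lia.
have -> : (n - k.+1 = n.-1 - k)%N by have := ltn_ord k; lia.
by rewrite !exprS; ring.
Qed.

(** * Second order Taylor expansion relative to an interval *)

(** Without a quotient, the condition also makes sense at y = x, which allows
    the punctured neighbourhood to be replaced by a full one. *)
Lemma has_derivative_on_near (R : realType) (A : set R) (f g : R -> R) (x : R) :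
  has_derivative_on A f g -> A x -> forall e, 0 < e ->
  \forall y \near x, A y -> `|f y - f x - g x * (y - x)| <= e * `|y - x|.
Proof.
move=> dfg Ax e e0; have /cvgrPdist_le/(_ e e0) := dfg x Ax.
rewrite /= !near_withinE => H.
near=> y => Ay; have [->|yx] := eqVneq y x.
  by rewrite !subrr mulr0 subrr normr0 mulr0.
have : `|g x - (f y - f x) / (y - x)| <= e.
  by move: yx Ay; near: y; exact: H.
have yx0 : y - x != 0 by rewrite subr_eq0.
move=> /(ler_wpM2r (normr_ge0 (y - x))); rewrite -normrM mulrBl divfK//.
by rewrite distrC.
Unshelve. all: by end_near. Qed.

Lemma is_derive_near (R : realType) (f : R -> R) (x d : R) :
  (forall e, 0 < e ->
     \forall y \near x, `|f y - f x - d * (y - x)| <= e * `|y - x|) ->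
  is_derive x 1 f d.
Proof.
move=> H.
have cv : h^-1 *: (f (h *: (1 : R) + x) - f x) @[h --> 0^'] --> d.
  apply/cvgrPdist_le => e e0.
  have /nbhs_ballP[r r0 rP] := H e e0.
  near=> h.
  have h0 : h != 0 by near: h; exact: nbhs_dnbhs_neq.
  have hr : `|h| < r by near: h; exact: dnbhs0_lt.
  have := rP (h + x).
  rewrite /ball/= opprD addrCA subrr addr0 normrN addrK => /(_ hr) hd.
  rewrite [h *: 1]mulr1 /GRing.scale/=.
  rewrite -(ler_pM2r (_ : 0 < `|h|)) ?normr_gt0// -normrM mulrBl.
  by rewrite mulrAC mulVf// mul1r distrC.
by apply: DeriveDef; [apply/cvg_ex; exists d|exact/cvg_lim].
Unshelve. all: by end_near. Qed.

Lemma bounded_has_derivative_on (R : realType) (a b : R) (f g : R -> R) :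
  has_derivative_on `[a, b] f g ->
  exists2 B, 0 < B & forall t, a <= t <= b -> `|f t| <= B.
Proof.
move=> dfg.
have cf : {within `[a, b], continuous f}.
  apply/subspace_continuousP => t tab; apply/cvgrPdist_le => e e0.
  rewrite near_withinE.
  pose c := 1 + `|g t|.
  have c0 : 0 < c by rewrite ltr_pwDl.
  have ball_t : \forall y \near t, `|t - y| < e / c.
    exact: near_ball (divr_gt0 e0 c0).
  near=> y => yab.
  have : `|f y - f t - g t * (y - t)| <= 1 * `|y - t|.
    by move: yab; near: y; exact: has_derivative_on_near.
  have yt : `|y - t| <= e / c.
    by rewrite distrC ltW//; near: y; exact: ball_t.
  move=> h; rewrite distrC -(subrK (g t * (y - t)) (f y - f t)).
  apply: (le_trans (ler_normD _ _)).
  rewrite normrM -(divfK (lt0r_neq0 c0) e).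
  apply: (@le_trans _ _ (`|y - t| * c)); last by rewrite ler_wpM2r// ltW.
  by rewrite [leRHS]mulrDr mulr1 [`|g t| * _]mulrC lerD// (le_trans h)// mul1r.
have /compact_bounded := continuous_compact cf (@segment_compact _ _ _).
move=> /pinfty_ex_gt0[B B0 HB]; exists B => // t tab.
by apply: HB; exists t => //=; rewrite in_itv.
Unshelve. all: by end_near. Qed.

(** Near x the remainder h has h' = o(t - x), so the mean value theorem gives
    |h(t)| <= e (t - x)^2.  At distance at least r from x the remainder is
    bounded by a constant K, hence by (K / r^4) (t - x)^4. *)
Lemma C2_taylor (R : realType) (f : R -> R) (x : R) :
  C2_on `[0, 1] f -> 0 < x < 1 ->
  exists a : R, forall e, 0 < e -> exists2 C, 0 <= C &
    forall t, 0 <= t <= 1 ->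
      `|f t - f x - a * (t - x) - 2^-1 * derive1n 2 f x * (t - x) ^+ 2|
        <= e * (t - x) ^+ 2 + C * (t - x) ^+ 4.
Proof.
move=> [f1 [f2 [df1 df2 _]]] x01.
have near01 (y : R) : 0 < y < 1 -> \forall z \near y, 0 < z < 1.
  move=> y01.
  have /near_in_itvoo : y \in `]0, 1[ by rewrite in_itv.
  by apply: filterS => z /[!in_itv].
have near01' (y : R) : 0 < y < 1 -> \forall z \near y, `[0, 1]%classic z.
  move=> /near01; apply: filterS => z /= /andP[z0 z1].
  by rewrite in_itv/= !ltW.
have in01 (y : R) : 0 < y < 1 -> `[0, 1]%classic y.
  by move=> /andP[y0 y1] /=; rewrite in_itv/= !ltW.
have der (g dg : R -> R) (y : R) : has_derivative_on `[0, 1] g dg -> 0 < y < 1 ->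
    is_derive y 1 g (dg y).
  move=> hg y01; apply: is_derive_near => e e0.
  near=> z; have z01 : `[0, 1]%classic z by near: z; exact: near01'.
  by move: z01; near: z; exact: has_derivative_on_near (in01 _ y01) _ e0.
have -> : derive1n 2 f x = f2 x.
  rewrite derive1nS derive1n1 derive1E.
  rewrite (@near_eq_derive _ _ _ _ f1).
    by have := der _ _ _ df2 x01 => /@derive_val.
  near=> z; have z01 : 0 < z < 1 by near: z; exact: near01.
  by rewrite derive1E; have := der _ _ _ df1 z01 => /@derive_val.
exists (f1 x) => e e0.
pose h t := f t - f x - f1 x * (t - x) - 2^-1 * f2 x * (t - x) ^+ 2.
pose dh t := f1 t - f1 x - f2 x * (t - x).
have dhP (t : R) : 0 < t < 1 -> is_derive t 1 h (dh t).
  move=> t01; have ? := der _ _ _ df1 t01.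
  apply: is_derive_eq; rewrite /dh /GRing.scale /=.
  by field.
have hx : h x = 0 by rewrite /h !subrr expr0n/= !mulr0 !subr0.
have [r r0 rP] : exists2 r, 0 < r & forall t, `|t - x| < r ->
    0 < t < 1 /\ `|dh t| <= e * `|t - x|.
  have : \forall t \near x, 0 < t < 1 /\ `|dh t| <= e * `|t - x|.
    near=> t; have t01 : 0 < t < 1 by near: t; exact: near01.
    split=> //; have := in01 _ t01; near: t.
    exact: has_derivative_on_near (in01 _ x01) _ e0.
  by move=> /nbhs_ballP[r r0 rP]; exists r => // t tr; apply: rP; rewrite /ball/= distrC.
have near_h (t : R) : `|t - x| < r -> `|h t| <= e * (t - x) ^+ 2.
  move=> tr.
  have between (c : R) : c \in `[Num.min t x, Num.max t x] -> `|c - x| <= `|t - x|.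
    rewrite in_itv/=; case: (leP t x) => tx /andP[c1 c2].
      by rewrite !ler0_norm ?subr_le0//; lra.
    by rewrite !ger0_norm ?subr_ge0//; lra.
  have inside (c : R) : c \in `[Num.min t x, Num.max t x] -> 0 < c < 1.
    by move=> /between cr; case: (rP c) => //; exact: le_lt_trans tr.
  have [|||c cI hc] := @MVT_segment _ h dh (Num.min t x) (Num.max t x).
  - by rewrite le_max !ge_min !lexx orbT.
  - by move=> c cI; apply/dhP/inside; exact: subset_itv_oo_cc.
  - apply: derivable_within_continuous => c /inside /dhP.
    by move=> /@ex_derive.
  have -> : `|h t| = `|dh c| * `|t - x|.
    move: hc; case: (leP t x) => tx; rewrite hx => hc.
      by rewrite (distrC t) -normrM -hc sub0r normrN.
    by rewrite -normrM -hc subr0.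
  have cr := between _ cI.
  have [//|_ dc] := rP c; first exact: le_lt_trans tr.
  rewrite -[(t - x) ^+ 2]real_normK ?num_real// expr2 mulrA ler_wpM2r//.
  by rewrite (le_trans dc)// ler_wpM2l// ltW.
have [B B0 fB] := bounded_has_derivative_on df1.
pose K : R := B + `|f x| + `|f1 x| + `|2^-1 * f2 x|.
have K0 : 0 <= K by rewrite !addr_ge0// ltW.
exists (K / r ^+ 4) => [|t t01].
  by rewrite divr_ge0// exprn_ge0// ltW.
rewrite -/(h t); have [tr|rt] := ltP `|t - x| r.
  rewrite (le_trans (near_h _ tr))// lerDl mulr_ge0 ?exprn_even_ge0//.
  by rewrite divr_ge0// exprn_ge0// ltW.
have tx1 : `|t - x| <= 1 by rewrite ler_norml; lra.
have hK : `|h t| <= K.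
  rewrite /h !(le_trans (ler_normB _ _))// lerD//; last first.
    by rewrite normrM ler_piMr// normrX exprn_ile1.
  rewrite (le_trans (ler_normB _ _))// lerD//; last first.
    by rewrite normrM ler_piMr.
  by rewrite (le_trans (ler_normB _ _))// lerD// fB.
have quad0 : 0 <= e * (t - x) ^+ 2 by rewrite mulr_ge0 ?sqr_ge0// ltW.
rewrite (le_trans hK)// ler_wpDl//.
rewrite -mulrA ler_peMr// mulrC ler_pdivlMr ?exprn_gt0// mul1r.
rewrite -[leRHS]ger0_norm ?exprn_even_ge0// normrX.
by rewrite lerXn2r// ?nnegrE ?(ltW r0).
Unshelve. all: by end_near. Qed.

(** * The Voronovskaja theorem *)

Theorem theorem14 (R : realType) (Q : nat -> {poly R}) (w : nat -> nat -> R)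
  (Qdeg : forall n : nat, (1 <= n)%N -> (size (Q n.-1) <= n)%N)
  (Qpos : forall n : nat, (1 <= n)%N ->
     forall x : R, 0 <= x <= 1 -> 0 < (Q n.-1).[x])
  (Qw : forall n : nat, (1 <= n)%N -> bernstein_coefs n (Q n.-1) (w n.-1))
  (wpos : forall n : nat, (1 <= n)%N ->
     forall k : nat, (k <= n.-1)%N -> 0 < w n.-1 k)
  (wW : forall n : nat, (1 <= n)%N -> property_W n (w n.-1))
  (mesh0 : mesh n (w n.-1) @[n --> \oo] --> (0 : R))
  (f : R -> R) (f_C2 : C2_on `[0, 1] f) (x : R) (x01 : 0 < x < 1) :
  (rat_bernstein n (Q n.-1) (w n.-1) f x - f x) /
    rat_bernstein n (Q n.-1) (w n.-1) (fun t : R => (t - x) ^+ 2) x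
    @[n --> \oo] --> 2^-1 * derive1n 2 f x.
Proof.
have [a taylor] := C2_taylor f_C2 x01.
have xI : 0 <= x <= 1 by case/andP: x01 => x0 x1; rewrite !ltW.
apply/cvgrPdist_le => e e0.
have e2 : 0 < e / 2 by rewrite divr_gt0.
have [C C0 {}taylor] := taylor (e / 2) e2.
have C1 : 0 < C + 1 by rewrite ltr_wpDl.
(* This bound on the mesh makes 3/2 C times the mesh at most e / 2. *)
have d0 : 0 < e / (3 * (C + 1)) by rewrite divr_gt0// mulr_gt0.
have /cvgrPdist_le/(_ _ d0) small := mesh0.
near=> n.
have n1 : (1 <= n)%N by near: n; exists 1%N.
have meshn : mesh n (w n.-1) <= e / (3 * (C + 1)).
  rewrite (le_trans (ler_norm _))// -normrN -sub0r.
  by near: n; exact: small.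
have w0 := wpos n n1.
have Q0 := Qpos n n1 x xI.
pose p := rb_weight n (Q n.-1) (w n.-1) x.
pose t := bnode n (w n.-1).
have p0 k : (k <= n)%N -> 0 < p k by move=> kn; exact: rb_weight_gt0.
(* The node 0 alone contributes p_0 x^2 > 0 to the second moment. *)
have M2gt0 : 0 < \sum_(k < n.+1) p k * (t k - x) ^+ 2.
  rewrite big_ord_recl/= ltr_pwDl//.
    rewrite mulr_gt0 ?p0// /t bnode0 sub0r sqrrN exprn_gt0//.
    by case/andP: x01.
  by apply: sumr_ge0 => k _; rewrite mulr_ge0 ?sqr_ge0// ltW// p0.
have gap k : (k < n)%N -> `|t k.+1 - t k| <= mesh n (w n.-1).
  move=> kn.
  exact: (le_bigmax 0 (fun k : 'I_n => `|t k.+1 - t k|) (Ordinal kn)).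
have := voronovskaja_estimate (rb_weight_balance (Q n.-1) x n1 w0)
  (bnode0 _ _) (bnode_last n1 w0) xI (fun k => bnode_itv n1 w0)
  (fun k kn => ltW (p0 k kn))
  (rb_weight_sum n1 (Qw n n1) (lt0r_neq0 Q0)) gap C0 taylor.
rewrite !rat_bernsteinE -/p -/t; set M2 := \sum_(k < n.+1) _ in M2gt0 *.
set A := _ - f x; set b := 2^-1 * _ => est.
have -> : b - A / M2 = - ((A - b * M2) / M2).
  by rewrite [in RHS]mulrBl mulfK ?lt0r_neq0// opprB.
rewrite normrN normrM normfV (gtr0_norm M2gt0) ler_pdivrMr//.
rewrite (le_trans est)// ler_wpM2r ?(ltW M2gt0)//.
have mesh_ge0 := le_trans (normr_ge0 _) (gap 0%N n1).
move: meshn; rewrite ler_pdivlMr ?mulr_gt0// => meshn; lra.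
Unshelve. all: by end_near. Qed.
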